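(* Let $d\ge 2$, let $\bar\tau$ be a binary dimension tree with leaves $L(\bar\tau)=\{1,\dots,d\}$, let $\mathbf A_k\in\mathbb C^{n_k\times n_k}$ for $k=1,\dots,d$, let $\boldsymbol\beta=(\beta(i,j))_{i,j=1}^d\in\mathbb C^{d\times d}$ be strictly upper triangular, and let $$\widehat H=\sum_{1\le i<j\le d}\beta(i,j)\,\mathbf A^{(i)}\mathbf A^{(j)}\in\mathbb C^{(n_1\cdots n_d)\times(n_1\cdots n_d)},\qquad \mathbf A^{(k)}=\mathbf I_{n_d}\otimes\cdots\otimes\mathbf I_{n_{k+1}}\otimes\mathbf A_k\otimes\mathbf I_{n_{k-1}}\otimes\cdots\otimes\mathbf I_{n_1}.$$ If $\boldsymbol\beta$ admits an HSS decomposition on $\bar\tau$ with ranks $k_\tau$, then there exists a TTNO representation $H$ of $\widehat H$ on $\bar\tau$ with ranks $r_\tau=2+k_\tau$ for every subtree $\tau\in\mathcal T(\bar\tau)\setminus\{\bar\tau\}$ and $r_\ell=2$ for every leaf $\ell\in L(\bar\tau)$.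
   Context: Binary dimension tree: a rooted tree $\bar\tau$ with leaf set $L(\bar\tau)=\{1,\dots,d\}$ defined recursively. A tree with a single leaf $\ell$ is $\tau=\ell$. A tree with more than one leaf is $\tau=(\tau_1,\tau_2)$, where the root has two children that are roots of dimension trees $\tau_1,\tau_2$, and $L(\tau)$ is the disjoint union of $L(\tau_1)$ and $L(\tau_2)$ with $\max L(\tau_1)<\min L(\tau_2)$. Leaf sets are always nonempty sets of consecutive integers. $\mathcal T(\bar\tau)$ denotes the set of all non-leaf subtrees $\tau=(\tau_1,\tau_2)$ occurring in this recursive construction (including $\bar\tau$ itself). $d_\tau$ is the cardinality of $L(\tau)$. Tree tensor network (TTN) on $\bar\tau$ with mode sizes $N_1,\dots,N_d$ and ranks $r_\tau$ ($\tau\in\mathcal T(\bar\tau)\cup L(\bar\tau)$, with $r_{\bar\tau}=1$ for the root): the data consist of basis matrices $\mathbf U_\ell\in\mathbb C^{N_\ell\times r_\ell}$ at the leaves and transfer tensors $C_\tau\in\mathbb C^{r_{\tau_1}\times r_{\tau_2}\times r_\tau}$ for $\tau=(\tau_1,\tau_2)\in\mathcal T(\bar\tau)$ (no rank conditions are imposed on these). Recursively, for $\tau=(\tau_1,\tau_2)$, $\mathbf U_\tau=(\mathbf U_{\tau_2}\otimes\mathbf U_{\tau_1})\,\mathrm{Mat}_{1,2}(C_\tau)$, where $\mathrm{Mat}_{1,2}(C_\tau)\in\mathbb C^{(r_{\tau_1}r_{\tau_2})\times r_\tau}$ merges the first two indices of $C_\tau$ into a row index with the first index running fastest. The tensor $X\in\mathbb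 C^{N_1\times\cdots\times N_d}$ represented by the TTN is the one with $\mathrm{vec}(X)=\mathbf U_{\bar\tau}$ (vectorization with first index fastest). TTNO: for a matrix $\widehat H\in\mathbb C^{(n_1\cdots n_d)\times(n_1\cdots n_d)}$, its reshape $H\in\mathbb C^{n_1^2\times\cdots\times n_d^2}$ is the image of $\widehat H$ under the linear bijection determined by $\mathbf B_d\otimes\cdots\otimes\mathbf B_1\mapsto\mathrm{vec}(\mathbf B_1)\circ\cdots\circ\mathrm{vec}(\mathbf B_d)$ for $\mathbf B_k\in\mathbb C^{n_k\times n_k}$ ($\circ$ is the outer product). A TTNO representation of $\widehat H$ on $\bar\tau$ with ranks $r_\tau$ is a TTN on $\bar\tau$ with mode sizes $N_\ell=n_\ell^2$ and ranks $r_\tau$ that represents $H$. HSS decomposition: write $\boldsymbol\beta(\tau_1,\tau_2)$ for the submatrix of $\boldsymbol\beta$ with rows in $L(\tau_1)$ and columns in $L(\tau_2)$. A strictly upper triangular $\boldsymbol\beta$ admits a hierarchically semi-separable (HSS) decomposition on $\bar\tau$ with ranks $k_\tau$ ($\tau$ ranging over all non-root subtrees and leaves) if there are matrices $\mathbf V_\tau\in\mathbb C^{d_\tau\times k_\tau}$ such that (1) for every $\tau=(\tau_1,\tau_2)\in\mathcal T(\bar\tau)$ there is $\mathbf S_{\tau_1,\tau_2}\in\mathbb C^{k_{\tau_1}\times k_{\tau_2}}$ with $\boldsymbol\beta(\tau_1,\tau_2)=\mathbf V_{\tau_1}\mathbf S_{\tau_1,\tau_2}\mathbf V_{\tau_2}^\top$;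 and (2) for every $\tau=(\tau_1,\tau_2)\in\mathcal T(\bar\tau)\setminus\{\bar\tau\}$ there is $\mathbf R_\tau\in\mathbb C^{(k_{\tau_1}+k_{\tau_2})\times k_\tau}$ with $\mathbf V_\tau=\begin{pmatrix}\mathbf V_{\tau_1}&0\\0&\mathbf V_{\tau_2}\end{pmatrix}\mathbf R_\tau$. *)

(* Defs.v *)
From mathcomp Require Import all_boot all_order all_algebra.
From mathcomp Require Import mxtens.

Set Implicit Arguments.
Unset Strict Implicit.
Unset Printing Implicit Defensive.

Import Order.TTheory GRing.Theory Num.Theory.
Local Open Scope ring_scope.

(** * Dimension trees

    The leaves [1, ..., d] are represented by [0, ..., d.-1 : 'I_d].  In a
    dimension tree distinct subtrees have distinct leaf sets, so a subtree is
    determined by its value, and families "indexed by the subtrees of [root]"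
    are functions on [dtree d]; values outside the subtrees of [root] play no
    role. *)

Inductive dtree (d : nat) : Type :=
| Leaf of 'I_d
| Node of dtree d & dtree d.

Fixpoint leaves d (t : dtree d) : {set 'I_d} :=
  match t with
  | Leaf l => [set l]
  | Node t1 t2 => leaves t1 :|: leaves t2
  end.

(* [max L(t1) < min L(t2)] at each node; this includes disjointness. *)
Fixpoint is_dimension_tree d (t : dtree d) : bool :=
  match t with
  | Leaf _ => true
  | Node t1 t2 =>
      [&& is_dimension_tree t1, is_dimension_tree t2
        & [forall i in leaves t1, forall j in leaves t2, (i < j)%N]]
  end.

Fixpoint subtree d (s t : dtree d) : Prop :=
  s = t \/ match t with
           | Leaf _ => False
           | Node t1 t2 => subtree s t1 \/ subtree s t2
           end.

(* [d_t = #|leaves t|] for a dimension tree, computed along the tree so that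
   [nleaves (Node t1 t2)] is definitionally [nleaves t1 + nleaves t2]. *)
Fixpoint nleaves d (t : dtree d) : nat :=
  match t with
  | Leaf _ => 1
  | Node t1 t2 => nleaves t1 + nleaves t2
  end.

(* The [p]-th leaf from the left, i.e. in increasing order for a dimension
   tree. *)
Fixpoint leaf_at d (t : dtree d) : 'I_(nleaves t) -> 'I_d :=
  match t with
  | Leaf l => fun=> l
  | Node t1 t2 => fun p =>
      match split p with
      | inl p1 => leaf_at p1
      | inr p2 => leaf_at p2
      end
  end.

(** * Tensors *)

Definition tensor (F : fieldType) d (N : 'I_d -> nat) : Type :=
  {ffun {dffun forall k : 'I_d, 'I_(N k)} -> F^o}.

(* Column-major vectorization; [mxvec] is row-major. *)
Definition vec (F : fieldType) m n (B : 'M[F]_(m, n)) : 'cV[F]_(n * m) :=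
  (mxvec B^T)^T.

Definition outer (F : fieldType) d (N : 'I_d -> nat)
    (v : forall k, 'cV[F]_(N k)) : tensor F N :=
  [ffun i : {dffun forall k : 'I_d, 'I_(N k)} => \prod_(k < d) v k (i k) 0].

Lemma digit_subproof d (N : 'I_d -> nat) (p : 'I_(\prod_(k < d) N k))
    (k : 'I_d) :
  ((p %/ \prod_(l < d | (l < k)%N) N l) %% N k < N k)%N.
Proof.
rewrite ltn_mod; move: (leq_ltn_trans (leq0n p) (ltn_ord p)).
by rewrite (bigD1 k) //= muln_gt0 => /andP[].
Qed.

(* Multi-index at linear position [p], the first index running fastest:
   [p = \sum_k i_k * \prod_(l < k) N_l]. *)
Definition multi_index d (N : 'I_d -> nat) (p : 'I_(\prod_(k < d) N k)) :
    {dffun forall k : 'I_d, 'I_(N k)} :=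
  [ffun k => Ordinal (digit_subproof p k)].

Definition tvec (F : fieldType) d (N : 'I_d -> nat) (X : tensor F N) :
    'cV[F]_(\prod_(k < d) N k) :=
  \col_p X (multi_index p).

(** * Tree tensor networks *)

Record ttn (F : fieldType) d (N : 'I_d -> nat) (r : dtree d -> nat) := TTN {
  basis : forall l : 'I_d, 'M[F]_(N l, r (Leaf l));
  transfer : forall t1 t2 : dtree d,
    'I_(r t1) -> 'I_(r t2) -> 'I_(r (Node t1 t2)) -> F
}.

(* [Mat_{1,2}]: in [mxtens_index (j, i)] the second component [i] runs
   fastest, so the first index of the tensor is put second. *)
Definition mat12 (F : fieldType) r1 r2 r0
    (C : 'I_r1 -> 'I_r2 -> 'I_r0 -> F) : 'M[F]_(r2 * r1, r0) :=
  \matrix_(p, q) let ji := mxtens_unindex p in C ji.2 ji.1 q.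

Fixpoint tree_size d (N : 'I_d -> nat) (t : dtree d) : nat :=
  match t with
  | Leaf l => N l
  | Node t1 t2 => tree_size N t2 * tree_size N t1
  end.

Fixpoint ttn_mx (F : fieldType) d (N : 'I_d -> nat) (r : dtree d -> nat)
    (T : ttn F N r) (t : dtree d) : 'M[F]_(tree_size N t, r t) :=
  match t with
  | Leaf l => basis T l
  | Node t1 t2 => (ttn_mx T t2 *t ttn_mx T t1) *m mat12 (@transfer _ _ _ _ T t1 t2)
  end.

(* The cast exists exactly when [tree_size N root] is the product of the mode
   sizes and the root rank is 1. *)
Definition ttn_represents (F : fieldType) d (N : 'I_d -> nat)
    (r : dtree d -> nat) (T : ttn F N r) (root : dtree d) (X : tensor F N) :
    Prop :=
  exists e : (tree_size N root = \prod_(k < d) N k)%N * (r root = 1%N),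
    tvec X = castmx e (ttn_mx T root).

(** * Operators on the tensor product space, and their TTNO representations *)

(* [n_d * ... * n_1], bracketed as the type of [kron] requires. *)
Definition kron_size d (n : 'I_d -> nat) (s : seq 'I_d) : nat :=
  foldr (fun k m => m * n k)%N 1%N s.

Fixpoint kron_seq (F : fieldType) d (n : 'I_d -> nat)
    (B : forall k, 'M[F]_(n k)) (s : seq 'I_d) : 'M[F]_(kron_size n s) :=
  match s with
  | [::] => 1%:M
  | k :: s' => kron_seq B s' *t B k
  end.

(* [B_d (x) ... (x) B_1]: [enum 'I_d] is increasing, and its head becomes the
   rightmost factor. *)
Definition kron (F : fieldType) d (n : 'I_d -> nat)
    (B : forall k, 'M[F]_(n k)) : 'M[F]_(kron_size n (enum 'I_d)) :=
  kron_seq B (enum 'I_d).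

Definition site_op (F : fieldType) d (n : 'I_d -> nat)
    (A : forall k, 'M[F]_(n k)) (k : 'I_d) : 'M[F]_(kron_size n (enum 'I_d)) :=
  kron (fun l => if l == k then A l else 1%:M).

Definition interaction_op (F : fieldType) d (n : 'I_d -> nat)
    (A : forall k, 'M[F]_(n k)) (beta : 'M[F]_d) :
    'M[F]_(kron_size n (enum 'I_d)) :=
  \sum_(i < d) \sum_(j < d | (i < j)%N)
     beta i j *: (site_op A i *m site_op A j).

(* The map [phi] is unique, because the Kronecker products span. *)
Definition is_reshape (F : fieldType) d (n : 'I_d -> nat)
    (Hhat : 'M[F]_(kron_size n (enum 'I_d)))
    (H : tensor F (fun k => n k * n k)%N) : Prop :=
  exists phi : {linear 'M[F]_(kron_size n (enum 'I_d)) ->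
                  tensor F (fun k => n k * n k)%N},
    [/\ bijective phi,
        forall B : (forall k, 'M[F]_(n k)),
          phi (kron B) = outer (fun k => vec (B k))
      & H = phi Hhat].

Definition is_ttno (F : fieldType) d (n : 'I_d -> nat) (r : dtree d -> nat)
    (root : dtree d) (Hhat : 'M[F]_(kron_size n (enum 'I_d)))
    (T : ttn F (fun k => n k * n k)%N r) : Prop :=
  exists2 H : tensor F (fun k => n k * n k)%N,
    is_reshape Hhat H & ttn_represents T root H.

(** * Hierarchically semi-separable decompositions *)

Definition strictly_upper_triangular (F : fieldType) d (beta : 'M[F]_d) : Prop :=
  forall i j : 'I_d, (j <= i)%N -> beta i j = 0.

Definition leaf_block (F : fieldType) d (beta : 'M[F]_d) (t1 t2 : dtree d) :
    'M[F]_(nleaves t1, nleaves t2) :=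
  mxsub (@leaf_at d t1) (@leaf_at d t2) beta.

Definition has_hss (F : fieldType) d (root : dtree d) (k : dtree d -> nat)
    (beta : 'M[F]_d) : Prop :=
  exists V : forall t : dtree d, 'M[F]_(nleaves t, k t),
    (forall t1 t2, subtree (Node t1 t2) root ->
       exists S : 'M[F]_(k t1, k t2),
         leaf_block beta t1 t2 = V t1 *m S *m (V t2)^T) /\
    (forall t1 t2, subtree (Node t1 t2) root -> Node t1 t2 <> root ->
       exists R : 'M[F]_(k t1 + k t2, k (Node t1 t2)),
         V (Node t1 t2) = block_mx (V t1) 0 0 (V t2) *m R).

(* Main.v *)
(* At a subtree with identity column E, interaction column Q and HSS-weighted
   single-site columns W_c (c < k), the pairs of sites in different children
   contribute W1 S W2^T, so that
     E = E1 E2,  Q = Q1 E2 + E1 Q2 + sum S(c1, c2) W1_c1 W2_c2,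
   and the nestedness of V writes each W_c as a combination of the W1_c1 E2 and
   the E1 W2_c2.  Thus 2 + k columns suffice at an inner node; at a leaf Q = 0
   and each W_c is a multiple of vec (A l), so 2 columns suffice; at the root
   only Q is kept. *)

From HB Require Import structures.
Require Import Defs.
From mathcomp Require Import all_boot all_order all_algebra.
From mathcomp Require Import complex reals mxtens.

Set Implicit Arguments.
Unset Strict Implicit.
Unset Printing Implicit Defensive.

Import Order.TTheory GRing.Theory Num.Theory.
Local Open Scope ring_scope.

(** * Digit arithmetic, sum exchanges and pseudoinverses *)

Lemma modn_mul_split p a b : (p %% (a * b) = p %/ a %% b * a + p %% a)%N.
Proof.
rewrite modn_divl [(b * a)%N]mulnC [in LHS](divn_eq (p %% (a * b)) a).
by rewrite modn_dvdm ?dvdn_mulr.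
Qed.

Lemma exchange_big4 (M : nmodType) (I J X Y : finType)
    (f : I -> J -> X -> Y -> M) :
  \sum_a \sum_b \sum_x \sum_y f a b x y =
  \sum_x \sum_y \sum_a \sum_b f a b x y.
Proof.
rewrite (pair_bigA _ (fun a b => \sum_x \sum_y f a b x y)) /=.
under eq_bigr => p _ do rewrite (pair_bigA _ (f p.1 p.2)) /=.
rewrite exchange_big /= [RHS](pair_bigA _ (fun x y => \sum_a \sum_b f a b x y)).
apply: eq_bigr => q _.
by rewrite /= (pair_bigA _ (fun a b => f a b q.1 q.2)).
Qed.

Lemma sum_mxtens_index (M : nmodType) m p (f : 'I_(m * p) -> M) :
  \sum_q f q = \sum_a \sum_b f (mxtens_index (a, b)).
Proof.
rewrite pair_bigA (reindex (@mxtens_index m p)) /=.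
  by apply: eq_bigr => -[].
by exists (@mxtens_unindex m p) => ? _;
  rewrite (mxtens_indexK, mxtens_unindexK).
Qed.

Lemma bilinear_rowE (R : comPzRingType) m n (u : 'rV[R]_m) (M : 'M_(m, n))
    (v : 'rV_n) :
  (u *m M *m v^T) 0 0 = \sum_i \sum_j M i j * (u 0 i * v 0 j).
Proof.
rewrite mxE exchange_big; apply: eq_bigr => j _.
rewrite !mxE mulr_suml; apply: eq_bigr => i _.
by rewrite mulrA [M i j * _]mulrC.
Qed.

(** The matrix [M *m pinvmx M] acts as the identity on the column space of [M]. *)
Lemma mulmx_pinvmxK (F : fieldType) m n p (M : 'M[F]_(m, n))
    (X : 'M_(n, p)) :
  M *m (pinvmx M *m (M *m X)) = M *m X.
Proof. by rewrite (mulmxA M) (mulmxA _ M X) mulmxKpV. Qed.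

(** * The reshape of the interaction operator *)

Section Reshape.

Variables (F : fieldType) (d : nat) (n : 'I_d -> nat).

Fixpoint kron_index (s : seq 'I_d) (f : forall k, 'I_(n k)) :
    'I_(kron_size n s) :=
  match s with
  | [::] => ord0
  | k :: s' => mxtens_index (kron_index s' f, f k)
  end.

Lemma kron_seqE (B : forall k, 'M[F]_(n k)) s f g :
  kron_seq B s (kron_index s f) (kron_index s g) =
  \prod_(k <- s) B k (f k) (g k).
Proof.
elim: s => [|k s IHs] /=; first by rewrite mxE big_nil.
by rewrite tensmxE IHs big_cons mulrC.
Qed.

Lemma kron_index_inj s f g :
  kron_index s f = kron_index s g -> {in s, forall k, f k = g k}.
Proof.
elim: s => [|k s IHs] //= /(congr1 (@mxtens_unindex _ _)).
rewrite !mxtens_indexK => -[/IHs eq_s eq_k] l.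
by rewrite inE => /predU1P[->|/eq_s].
Qed.

Lemma eq_kron_index s (f g : forall k, 'I_(n k)) :
  (forall k, f k = g k) -> kron_index s f = kron_index s g.
Proof. by move=> eq_fg; elim: s => //= k s ->; rewrite eq_fg. Qed.

Lemma kron_sizeE s : kron_size n s = (\prod_(k <- s) n k)%N.
Proof. by elim: s => [|k s IHs] /=; rewrite ?big_nil // big_cons mulnC IHs. Qed.

Lemma kron_index_bij :
  bijective (fun f : {dffun forall k : 'I_d, 'I_(n k)} =>
    kron_index (enum 'I_d) f).
Proof.
apply: inj_card_bij => [f g /kron_index_inj eq_fg|].
  by apply/ffunP => k; apply: eq_fg; rewrite mem_enum.
rewrite card_ord card_dep_ffun kron_sizeE foldrE big_enum.
by rewrite big_image /=; under [leqRHS]eq_bigr do rewrite card_ord.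
Qed.

Lemma kron_mul (B C : forall k, 'M[F]_(n k)) :
  kron B *m kron C = kron (fun k => B k *m C k).
Proof.
rewrite /kron; elim: (enum _) => [|k s IHs] /=; first by rewrite mul1mx.
by rewrite tensmx_mul IHs.
Qed.

(* Row and column of the entry at position [p] of a column-major
   vectorization. *)
Definition entry_index m (p : 'I_(m * m)) : 'I_m * 'I_m :=
  let x := enum_val (cast_ord (esym (mxvec_cast m m)) p) in (x.2, x.1).

Lemma entry_indexK m (a b : 'I_m) : entry_index (mxvec_index b a) = (a, b).
Proof. by rewrite /entry_index cast_ordK enum_rankK. Qed.

Lemma vecE m (B : 'M[F]_m) p :
  vec B p 0 = B (entry_index p).1 (entry_index p).2.
Proof.
by rewrite mxE; case/mxvec_indexP: p => b a; rewrite mxvecE mxE entry_indexK.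
Qed.

Definition reshape (M : 'M[F]_(kron_size n (enum 'I_d))) :
    tensor F (fun k => n k * n k)%N :=
  [ffun i : {dffun forall k : 'I_d, 'I_(n k * n k)} =>
     M (kron_index (enum 'I_d) (fun k => (entry_index (i k)).1))
       (kron_index (enum 'I_d) (fun k => (entry_index (i k)).2))].

Lemma reshape_is_linear : linear reshape.
Proof. by move=> a M N; apply/ffunP => i; rewrite !ffunE !mxE. Qed.

HB.instance Definition _ := GRing.isLinear.Build F
  'M[F]_(kron_size n (enum 'I_d)) (tensor F (fun k => n k * n k)%N) _ reshape
  reshape_is_linear.

Lemma reshape_bij : bijective reshape.
Proof.
have [u idxK uK] := kron_index_bij.
(* The column digit comes first because [vec] transposes before the row-major [mxvec]. *)
exists (fun H : tensor F (fun k => n k * n k)%N => \matrix_(p, q)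
  H [ffun k => mxvec_index (u q k) (u p k)]) => [M|H].
  apply/matrixP => p q; rewrite mxE ffunE -[in RHS](uK p) -[in RHS](uK q).
  by congr (M _ _); apply: eq_kron_index => k; rewrite ffunE entry_indexK.
apply/ffunP => i; rewrite ffunE mxE; congr (H _); apply/ffunP => k.
rewrite ffunE.
have uE (f : forall k, 'I_(n k)) l : u (kron_index (enum 'I_d) f) l = f l.
  rewrite (@eq_kron_index _ f [ffun l => f l]) ?idxK ?ffunE // => j.
  by rewrite ffunE.
by rewrite !uE; case/mxvec_indexP: (i k) => b a; rewrite entry_indexK.
Qed.

Lemma reshape_kron B : reshape (kron B) = outer (fun k => vec (B k)).
Proof.
apply/ffunP => i; rewrite !ffunE kron_seqE big_enum /=.
by apply: eq_bigr => k _; rewrite vecE.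
Qed.

(** By the mixed-product rule [kron_mul], a product of two site operators is one Kronecker product;
    [a < b] keeps the two sites distinct, so no factor becomes a square of [A l]. *)
Lemma reshape_interaction (A : forall k, 'M[F]_(n k)) (beta : 'M[F]_d)
    (i : {dffun forall k : 'I_d, 'I_(n k * n k)}) :
  reshape (interaction_op A beta) i =
  \sum_(a < d) \sum_(b < d | (a < b)%N) beta a b *
    \prod_(l < d) if (l == a) || (l == b) then vec (A l) (i l) 0
                  else vec 1%:M (i l) 0.
Proof.
rewrite linear_sum sum_ffunE; apply: eq_bigr => a _.
rewrite linear_sum sum_ffunE; apply: eq_bigr => b ltab.
rewrite linearZ kron_mul /= reshape_kron !ffunE; congr (_ * _).
apply: eq_bigr => l _; case: eqP => [->|_].
  by rewrite (ltn_eqF ltab : (a == b) = false) mulmx1.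
by rewrite mul1mx; case: eqP.
Qed.

End Reshape.

(** * Leaf order and tree indices *)

Section LeafSequence.

Variable d : nat.
Implicit Types t : dtree d.

Local Notation ltI := (fun a b : 'I_d => (a < b)%N).

Fixpoint leaf_seq t : seq 'I_d :=
  match t with
  | Leaf l => [:: l]
  | Node t1 t2 => leaf_seq t1 ++ leaf_seq t2
  end.

Lemma mem_leaf_seq t : leaf_seq t =i leaves t.
Proof.
elim: t => [l|t1 IH1 t2 IH2] a /=; first by rewrite !inE.
by rewrite mem_cat IH1 IH2 inE.
Qed.

Lemma leaf_seq_pairwise t : is_dimension_tree t -> pairwise ltI (leaf_seq t).
Proof.
elim: t => //= t1 IH1 t2 IH2 /and3P[/IH1 pw1 /IH2 pw2 lt12].
rewrite pairwise_cat pw1 pw2 !andbT; apply/allrelP => a b.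
rewrite !mem_leaf_seq => t1a t2b.
by move/forall_inP: lt12 => /(_ a t1a)/forall_inP; apply.
Qed.

Lemma enum_ord_pairwise : pairwise ltI (enum 'I_d).
Proof.
rewrite -(pairwise_map val ltn) val_enum_ord -sorted_pairwise.
  exact: iota_ltn_sorted.
exact: ltn_trans.
Qed.

Lemma leaf_seq_root t : is_dimension_tree t -> leaves t = [set: 'I_d] ->
  leaf_seq t = enum 'I_d.
Proof.
move=> /leaf_seq_pairwise pw_t t_full.
have tr : transitive ltI by move=> b a c; apply: ltn_trans.
apply: (irr_sorted_eq tr (fun a => ltnn a)).
- by rewrite sorted_pairwise.
- by rewrite sorted_pairwise // enum_ord_pairwise.
- by move=> a; rewrite mem_leaf_seq t_full inE mem_enum.
Qed.

Lemma nleaves_gt0 t : (0 < nleaves t)%N.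
Proof. by elim: t => //= t1 IH1 t2 _; rewrite ltn_addr. Qed.

(** Justifies recognizing the root among its subtrees by its number of leaves. *)
Lemma subtree_nleaves s t : subtree s t -> s = t \/ (nleaves s < nleaves t)%N.
Proof.
elim: t => [l|t1 IH1 t2 IH2] /= [->|]; [by left|by []|by left|].
have gt1 := nleaves_gt0 t1; have gt2 := nleaves_gt0 t2.
case=> [/IH1|/IH2] [->|lt_s]; right.
- by rewrite -addn1 leq_add2l.
- exact: leq_trans lt_s (leq_addr _ _).
- by rewrite -add1n leq_add2r.
- exact: leq_trans lt_s (leq_addl _ _).
Qed.

Lemma subtree_refl t : subtree t t.
Proof. by case: t => *; left. Qed.

Lemma subtree_trans s t u : subtree s t -> subtree t u -> subtree s u.
Proof.
move=> st; elim: u => [l|t1 IH1 t2 IH2]; case=> [<- //|] //.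
by case=> [/IH1|/IH2] ?; right; [left|right].
Qed.

Lemma subtree_childl t1 t2 u : subtree (Node t1 t2) u -> subtree t1 u.
Proof. by apply: subtree_trans; right; left; apply: subtree_refl. Qed.

Lemma subtree_childr t1 t2 u : subtree (Node t1 t2) u -> subtree t2 u.
Proof. by apply: subtree_trans; right; right; apply: subtree_refl. Qed.

Variable N : 'I_d -> nat.

(** The row of [ttn_mx T t] that belongs to [i]; the left child runs fastest, as in the product of
    the right factor with the left one. *)
Fixpoint tree_index t (i : forall k, 'I_(N k)) : 'I_(tree_size N t) :=
  match t with
  | Leaf l => i l
  | Node t1 t2 => mxtens_index (tree_index t2 i, tree_index t1 i)
  end.

(* The position of [i] in mixed radix, the head of [s] being the least
   significant digit. *)
Definition radix (i : forall k, 'I_(N k)) (s : seq 'I_d) : nat :=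
  foldr (fun k m => m * N k + i k)%N 0%N s.

Lemma tree_sizeE t : tree_size N t = (\prod_(k <- leaf_seq t) N k)%N.
Proof.
elim: t => [l|t1 IH1 t2 IH2] /=; first by rewrite big_seq1.
by rewrite big_cat IH1 IH2 mulnC.
Qed.

Lemma radix_cat i s1 s2 :
  radix i (s1 ++ s2) = (radix i s2 * (\prod_(k <- s1) N k) + radix i s1)%N.
Proof.
elim: s1 => [|k s1 IHs] /=; first by rewrite big_nil muln1 addn0.
by rewrite IHs big_cons mulnDl addnA -mulnA [(N k * _)%N]mulnC.
Qed.

Lemma tree_indexE t i : tree_index t i = radix i (leaf_seq t) :> nat.
Proof.
elim: t => [l|t1 IH1 t2 IH2] /=; first by rewrite mul0n.
by rewrite radix_cat IH1 IH2 tree_sizeE.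
Qed.

(** Induction on the suffix [s2]: dividing by the sizes of the prefix [s1] makes the first digit of
    [s2] the lowest one. *)
Lemma radix_multi_index (p : 'I_(\prod_(k < d) N k)) s1 s2 :
  s1 ++ s2 = enum 'I_d ->
  radix (multi_index p) s2 =
    ((p %/ \prod_(k <- s1) N k) %% \prod_(k <- s2) N k)%N.
Proof.
elim: s2 s1 => [|k s2 IHs] s1 def_s; first by rewrite big_nil modn1.
have def_s' : rcons s1 k ++ s2 = enum 'I_d by rewrite cat_rcons.
rewrite /= (IHs _ def_s') big_cons -cats1 big_cat big_seq1 divnMA.
rewrite modn_mul_split ffunE /=; congr (_ + _ %/ _ %% _)%N.
(* Since the enumeration is increasing, the indices below [k] are exactly those in [s1]. *)
have -> : (\prod_(l < d | l < k) N l = \prod_(l <- enum 'I_d | l < k) N l)%N.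
  by rewrite big_enum_cond; apply: eq_bigl.
rewrite -def_s big_cat /= big_cons ltnn.
have := enum_ord_pairwise; rewrite -def_s pairwise_cat.
case/and3P=> /allrelP lt_s1 _ /andP[/allP lt_s2 _].
rewrite [X in (_ * X)%N]big_seq_cond [X in (_ * X)%N]big1 ?muln1.
  rewrite big_seq_cond [RHS]big_seq; apply: eq_bigl => l.
  by apply: andb_idr => s1l; apply: lt_s1; rewrite // mem_head.
by move=> l /andP[/lt_s2/ltn_trans lt_kl /lt_kl]; rewrite ltnn.
Qed.

Lemma tree_index_multi_index t (p : 'I_(\prod_(k < d) N k)) :
  leaf_seq t = enum 'I_d -> tree_index t (multi_index p) = p :> nat.
Proof.
move=> def_s; rewrite tree_indexE def_s (@radix_multi_index p [::]) //.
by rewrite big_nil divn1 big_enum modn_small.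
Qed.

End LeafSequence.

(** * Column values and their recursion *)

Section TreeColumns.

Variables (F : fieldType) (d : nat) (beta : 'M[F]_d) (a0 a1 : 'I_d -> F).
Implicit Types t : dtree d.

(* [a0 l] and [a1 l] stand for the entries of [vec 1%:M] and [vec (A l)] at a
   fixed position of mode [l]. *)
Fixpoint identity_val t : F :=
  match t with
  | Leaf l => a0 l
  | Node t1 t2 => identity_val t1 * identity_val t2
  end.

(** Entry [p] belongs to the operator with [A] at the [p]-th leaf of [t] and the identity at its
    other leaves. *)
Fixpoint site_row t : 'rV[F]_(nleaves t) :=
  match t with
  | Leaf l => const_mx (a1 l)
  | Node t1 t2 => row_mx (identity_val t2 *: site_row t1)
                         (identity_val t1 *: site_row t2)
  end.

Fixpoint interaction_val t : F :=
  match t with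
  | Leaf l => 0
  | Node t1 t2 =>
      interaction_val t1 * identity_val t2 +
      identity_val t1 * interaction_val t2 +
      (site_row t1 *m leaf_block beta t1 t2 *m (site_row t2)^T) 0 0
  end.

Definition mark (X : pred 'I_d) (s : seq 'I_d) : F :=
  \prod_(l <- s) if X l then a1 l else a0 l.

Lemma mark_cat X s1 s2 : mark X (s1 ++ s2) = mark X s1 * mark X s2.
Proof. exact: big_cat. Qed.

Lemma eq_mark X Y s : {in s, X =1 Y} -> mark X s = mark Y s.
Proof. by move=> eqXY; apply: eq_big_seq => l /eqXY->. Qed.

Lemma identity_valE t : identity_val t = mark pred0 (leaf_seq t).
Proof.
elim: t => [l|t1 IH1 t2 IH2] /=; first by rewrite /mark big_seq1.
by rewrite mark_cat IH1 IH2.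
Qed.

(** The arbitrary weight [f] allows two applications to the bilinear form in [interaction_val], one
    over the columns of the block of [beta] and one over its rows. *)
Lemma site_rowE t (f : 'I_d -> F) :
  pairwise (fun a b : 'I_d => (a < b)%N) (leaf_seq t) ->
  \sum_p site_row t 0 p * f (leaf_at p) =
  \sum_(a <- leaf_seq t) mark (pred1 a) (leaf_seq t) * f a.
Proof.
elim: t => [l|t1 IH1 t2 IH2] /=.
  by rewrite big_ord1 big_seq1 mxE /mark big_seq1 /= eqxx.
rewrite pairwise_cat => /and3P[/allrelP lt12 /IH1 {}IH1 /IH2 {}IH2].
rewrite big_split_ord big_cat; congr (_ + _).
  under eq_bigr => p _.
    rewrite row_mxEl mxE -mulrA (unsplitK (inl p)); over.
  rewrite -mulr_sumr /= IH1 mulr_sumr; apply: eq_big_seq => a s1a.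
  rewrite mark_cat mulrA [_ * mark _ _]mulrC identity_valE; congr (_ * _ * _).
  by apply: eq_mark => b s2b /=; rewrite -val_eqE gtn_eqF ?lt12.
under eq_bigr => p _.
  rewrite row_mxEr mxE -mulrA (unsplitK (inr p)); over.
rewrite -mulr_sumr /= IH2 mulr_sumr; apply: eq_big_seq => b s2b.
rewrite mark_cat mulrA identity_valE; congr (_ * _ * _).
by apply: eq_mark => a s1a /=; rewrite -val_eqE ltn_eqF ?lt12.
Qed.

(** The pairs [a < b] lie both in [t1], both in [t2], or with [a] in [t1] and [b] in [t2], matching
    the three summands of the recursion; the leaf order rules out the fourth case. *)
Lemma interaction_valE t :
  pairwise (fun a b : 'I_d => (a < b)%N) (leaf_seq t) ->
  interaction_val t =
  \sum_(a <- leaf_seq t) \sum_(b <- leaf_seq t | (a < b)%N)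
    beta a b * mark (pred2 a b) (leaf_seq t).
Proof.
elim: t => [l _|t1 IH1 t2 IH2] /=.
  by rewrite big_seq1 big_mkcond big_seq1 ltnn.
rewrite pairwise_cat => /and3P[/allrelP lt12 pw1 pw2].
set s1 := leaf_seq t1; set s2 := leaf_seq t2.
have neq12 a b : a \in s1 -> b \in s2 -> (a == b) = false.
  by move=> s1a s2b; rewrite -val_eqE ltn_eqF ?lt12.
rewrite big_cat /= [RHS]addrC.
under [X in _ = _ + X]eq_bigr do rewrite big_cat /=.
rewrite big_split /= addrA addrAC [RHS]addrC [RHS]addrA; congr (_ + _ + _).
- rewrite IH1 // mulr_suml; apply: eq_big_seq => a s1a.
  rewrite mulr_suml big_seq_cond [RHS]big_seq_cond.
  apply: eq_bigr => b /andP[s1b _].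
  rewrite -mulrA mark_cat identity_valE; congr (_ * (_ * _)).
  by apply: eq_mark => c s2c; rewrite /= ![c == _]eq_sym !neq12.
- rewrite IH2 // mulr_sumr; apply: eq_big_seq => a s2a.
  rewrite big_cat /= [X in _ = X + _]big_seq_cond [X in _ = X + _]big1 ?add0r.
    rewrite mulr_sumr big_seq_cond [RHS]big_seq_cond.
    apply: eq_bigr => b /andP[s2b _].
    rewrite mulrCA mark_cat identity_valE; congr (_ * (_ * _)).
    by apply: eq_mark => c s1c; rewrite /= !neq12.
  by move=> b /andP[s1b]; rewrite ltnNge ltnW ?lt12.
rewrite bilinear_rowE.
transitivity (\sum_p site_row t1 0 p *
    \sum_(b <- s2) mark (pred1 b) s2 * beta (leaf_at p) b).
  apply: eq_bigr => p1 _; rewrite -site_rowE // mulr_sumr.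
  by apply: eq_bigr => p2 _; rewrite mxE mulrC mulrA.
rewrite (site_rowE (fun a => \sum_(b <- s2) mark (pred1 b) s2 * beta a b)) //.
apply: eq_big_seq => a s1a; rewrite mulr_sumr.
rewrite [RHS]big_seq_cond [LHS]big_seq_cond.
apply: eq_big => [b|b /andP[s2b _]].
  by rewrite andbT; apply/esym/andb_idr => s2b; apply: lt12.
rewrite mulrA [LHS]mulrC mark_cat; congr (_ * (_ * _)).
  by apply: eq_mark => c s1c; rewrite /= (neq12 c b) ?orbF.
by apply: eq_mark => c s2c; rewrite /= [c == a]eq_sym (neq12 a c).
Qed.

(** * HSS coefficients and the coupling of labels *)

Variables (k : dtree d -> nat) (V : forall t, 'M[F]_(nleaves t, k t)).

(* Pseudoinverses make the coefficients of the HSS decomposition explicit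
   functions of [V] and [beta]. *)
Definition hss_S t1 t2 : 'M[F]_(k t1, k t2) :=
  pinvmx (V t1) *m leaf_block beta t1 t2 *m pinvmx (V t2)^T.

Definition hss_R t1 t2 : 'M[F]_(k t1 + k t2, k (Node t1 t2)) :=
  pinvmx (block_mx (V t1) 0 0 (V t2)) *m V (Node t1 t2).

(** The factorization puts the columns of the block in the column space of [V t1] and its rows in
    the row space of [(V t2)^T], so both pseudoinverse projections fix it. *)
Lemma hss_SP t1 t2 S : leaf_block beta t1 t2 = V t1 *m S *m (V t2)^T ->
  leaf_block beta t1 t2 = V t1 *m hss_S t1 t2 *m (V t2)^T.
Proof.
move=> def_beta.
have VK : V t1 *m (pinvmx (V t1) *m leaf_block beta t1 t2) =
    leaf_block beta t1 t2 by rewrite def_beta -!(mulmxA (V t1)) mulmx_pinvmxK.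
by rewrite /hss_S (mulmxA (V t1)) VK mulmxKpV // def_beta submxMl.
Qed.

Lemma hss_RP t1 t2 R :
  V (Node t1 t2) = block_mx (V t1) 0 0 (V t2) *m R ->
  V (Node t1 t2) = block_mx (V t1) 0 0 (V t2) *m hss_R t1 t2.
Proof. by move=> defV; rewrite /hss_R defV mulmx_pinvmxK. Qed.

(* [inl false] labels the identity, [inl true] the interaction within the
   subtree, and [inr c] the single-site operators weighted by column [c] of
   [V t]. *)
Definition label t : finType := (bool + 'I_(k t))%type.

Definition label_val t (x : label t) : F :=
  match x with
  | inl false => identity_val t
  | inl true => interaction_val t
  | inr c => (site_row t *m V t) 0 c
  end.

(** The transfer tensor in label coordinates: its nonzero entries are the coefficients of the
    recursions for E, Q and W_c. *)
Definition coupling t1 t2 (x : label (Node t1 t2)) (x1 : label t1)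
    (x2 : label t2) : F :=
  match x, x1, x2 with
  | inl false, inl false, inl false => 1
  | inl true, inl true, inl false => 1
  | inl true, inl false, inl true => 1
  | inl true, inr c1, inr c2 => hss_S t1 t2 c1 c2
  | inr c, inr c1, inl false => hss_R t1 t2 (lshift _ c1) c
  | inr c, inl false, inr c2 => hss_R t1 t2 (rshift _ c2) c
  | _, _, _ => 0
  end.

Lemma sum_label t (f : label t -> F) :
  \sum_x f x = f (inl true) + f (inl false) + \sum_c f (inr c).
Proof. by rewrite big_sumType big_bool. Qed.

(** Nestedness is required only for the labels [inr c], so that the lemma also applies at the root,
    where no [hss_R] identity is available. *)
Lemma coupling_sum t1 t2 (x : label (Node t1 t2)) :
  leaf_block beta t1 t2 = V t1 *m hss_S t1 t2 *m (V t2)^T ->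
  (forall c, x = inr c ->
     V (Node t1 t2) = block_mx (V t1) 0 0 (V t2) *m hss_R t1 t2) ->
  \sum_x1 \sum_x2 coupling x x1 x2 * (label_val x1 * label_val x2) =
  label_val x.
Proof.
move=> defS defR.
have sum0r m (f : 'I_m -> F) : \sum_c 0 * f c = 0.
  by rewrite -mulr_sumr mul0r.
rewrite sum_label !sum_label.
under [X in _ + X = _]eq_bigr do rewrite sum_label.
case: x defR => [[]|c] defR /=.
- under [X in _ + X = _]eq_bigr do rewrite !mul0r !add0r.
  rewrite !mul0r !mul1r !add0r !addr0.
  rewrite !sum0r !addr0.
  by congr (_ + _); rewrite -bilinear_rowE trmx_mul defS !mulmxA.
- rewrite !mul0r !mul1r !add0r !sum0r !addr0 big1 ?addr0 ?add0r // => c _.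
  by rewrite !mul0r sum0r !addr0.
rewrite !mul0r !add0r !sum0r !add0r.
under [X in _ + X = _]eq_bigr => c1 _.
  rewrite mul0r add0r sum0r addr0.
  over.
rewrite (defR c) // mulmxA mul_row_block !mulmx0 addr0 add0r mxE big_split_ord.
rewrite [LHS]addrC; congr (_ + _); apply: eq_bigr => c' _.
  by rewrite row_mxEl -scalemxAl [in RHS]mxE mulrC [_ * identity_val _]mulrC.
by rewrite row_mxEr -scalemxAl [in RHS]mxE mulrC.
Qed.

End TreeColumns.

(** * The network *)

Section Construction.

Variables (F : fieldType) (d : nat) (n : 'I_d -> nat).
Variables (A : forall l : 'I_d, 'M[F]_(n l)) (beta : 'M[F]_d) (root : dtree d).
Variables (k : dtree d -> nat) (V : forall t, 'M[F]_(nleaves t, k t)).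

(* A subtree of [root] is [root] itself iff it has as many leaves. *)
Definition ttno_rank t : nat :=
  match t with
  | Leaf _ => 2
  | Node _ _ => if nleaves t == nleaves root then 1 else 2 + k t
  end.

(** The single root column carries the interaction. At any other node there are as many columns as
    labels, so the default of [nth] is never reached. *)
Definition column_label t (j : nat) : label k t :=
  if nleaves t == nleaves root then inl true
  else nth (inl true) (enum (label k t)) j.

(* Coordinates of the labelled vectors in the columns at [t]; at a leaf the two
   columns are [vec 1%:M] and [vec (A l)]. *)
Definition label_coord t (j : nat) : label k t -> F :=
  match t with
  | Leaf l => fun x =>
      match x with
      | inl false => (j == 0%N)%:R
      | inl true => 0
      | inr c => (j == 1%N)%:R * V (Leaf l) 0 c
      end
  | Node _ _ => fun x => (j == index x (enum (label k _)))%:R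
  end.

(** A leaf has two columns but [2 + k] labels, so [coupling] is composed with the coordinates of the
    child labels in the child columns. *)
Definition hss_ttno : ttn F (fun l => n l * n l)%N ttno_rank :=
  @TTN F d (fun l => n l * n l)%N ttno_rank
    (fun l => \matrix_(p, j)
       if j == 0%N :> nat then vec 1%:M p 0 else vec (A l) p 0)
    (fun t1 t2 j1 j2 j => \sum_x1 \sum_x2
       coupling beta V (column_label (Node t1 t2) j) x1 x2 *
       (label_coord j1 x1 * label_coord j2 x2)).

Hypothesis hssS : forall t1 t2, subtree (Node t1 t2) root ->
  leaf_block beta t1 t2 = V t1 *m hss_S beta V t1 t2 *m (V t2)^T.
Hypothesis hssR : forall t1 t2, subtree (Node t1 t2) root ->
  Node t1 t2 <> root ->
  V (Node t1 t2) = block_mx (V t1) 0 0 (V t2) *m hss_R V t1 t2.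

Variable i : forall l : 'I_d, 'I_(n l * n l).

Local Notation col_val :=
  (label_val beta (fun l => vec 1%:M (i l) 0) (fun l => vec (A l) (i l) 0) V).

Definition coords_ok t : Prop := forall x : label k t,
  \sum_j ttn_mx hss_ttno t (tree_index t i) j * label_coord j x = col_val x.

Lemma ttn_mx_node t1 t2 (j : 'I_(ttno_rank (Node t1 t2))) :
  subtree (Node t1 t2) root -> coords_ok t1 -> coords_ok t2 ->
  ttn_mx hss_ttno (Node t1 t2) (tree_index (Node t1 t2) i) j =
  col_val (column_label (Node t1 t2) j).
Proof.
move=> sub ok1 ok2; rewrite -coupling_sum; first last.
(* A label [inr c] occurs only when the leaf count differs from that of the root, hence at a node
   where [hssR] applies. *)
- move=> c; rewrite /column_label; case: eqP => // neq _; apply: hssR => //.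
  by move=> eq_root; case: neq; rewrite eq_root.
- exact: hssS.
rewrite [LHS]mxE sum_mxtens_index exchange_big /=.
transitivity (\sum_j1 \sum_j2 \sum_x1 \sum_x2
    coupling beta V (column_label (Node t1 t2) j) x1 x2 *
    ((ttn_mx hss_ttno t1 (tree_index t1 i) j1 * label_coord j1 x1) *
     (ttn_mx hss_ttno t2 (tree_index t2 i) j2 * label_coord j2 x2))).
  apply: eq_bigr => j1 _; apply: eq_bigr => j2 _.
  rewrite tensmxE mxE mxtens_indexK /= mulr_sumr; apply: eq_bigr => x1 _.
  rewrite mulr_sumr; apply: eq_bigr => x2 _.
  by rewrite mulrCA [_ * ttn_mx _ t1 _ _]mulrC mulrACA.
(* With the column sums innermost, each summand factors into the two sums evaluated by [ok1] and
   [ok2]. *)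
rewrite exchange_big4; apply: eq_bigr => x1 _; apply: eq_bigr => x2 _.
rewrite -ok1 -ok2 big_distrlr mulr_sumr.
by apply: eq_bigr => j1 _; rewrite mulr_sumr.
Qed.

(** At an inner node columns and labels correspond one to one and [label_coord] is a Kronecker
    delta. The root is excluded because it keeps only the interaction column. *)
Lemma subtree_coords_ok t :
  subtree t root -> nleaves t != nleaves root -> coords_ok t.
Proof.
elim: t => [l _ _|t1 IH1 t2 IH2 sub neq] x.
  rewrite (big_ord_recl 1) big_ord1 !mxE /=.
  case: x => [[]|c] /=; rewrite ?mulr0 ?mulr1 ?addr0 //.
    by rewrite [RHS]mxE.
  by rewrite mul0r mulr0 add0r mul1r [RHS]mxE big_ord1 !mxE.
have neq_child t : subtree t (Node t1 t2) -> t <> Node t1 t2 ->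
    subtree t root /\ nleaves t != nleaves root.
  move=> sub_t neq_t; have sub_r := subtree_trans sub_t sub; split=> //.
  have [//|lt_t] := subtree_nleaves sub_t.
  have [eq_r|lt_r] := subtree_nleaves sub; first by rewrite eq_r eqxx in neq.
  by rewrite ltn_eqF // (ltn_trans lt_t lt_r).
have [lt1 lt2] : (nleaves t1 < nleaves (Node t1 t2))%N /\
    (nleaves t2 < nleaves (Node t1 t2))%N.
  split=> /=; first by rewrite -addn1 leq_add2l nleaves_gt0.
  by rewrite -add1n leq_add2r nleaves_gt0.
have ok1 : coords_ok t1.
  have [||s1 n1] := neq_child t1; last exact: IH1.
    by apply: (@subtree_childl _ t1 t2); apply: subtree_refl.
  by move=> e; rewrite -e ltnn in lt1.
have ok2 : coords_ok t2.
  have [||s2 n2] := neq_child t2; last exact: IH2.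
    by apply: (@subtree_childr _ t1 t2); apply: subtree_refl.
  by move=> e; rewrite -e ltnn in lt2.
under eq_bigr do rewrite ttn_mx_node //.
have rank_t : ttno_rank (Node t1 t2) = #|label k (Node t1 t2)|.
  by rewrite /= (negPf neq) card_sum card_bool card_ord.
have lt_x : (index x (enum (label k (Node t1 t2))) < ttno_rank (Node t1 t2))%N.
  by rewrite rank_t cardT index_mem mem_enum.
rewrite (bigD1 (Ordinal lt_x)) //= eqxx mulr1 big1 ?addr0 => [|j neq_j].
  by rewrite /column_label (negPf neq) nth_index // mem_enum.
by rewrite -val_eqE /= in neq_j; rewrite (negPf neq_j) mulr0.
Qed.

(** Keeping [t] apart from [root] permits case analysis on [t] although the type of [j] depends on
    it; the bound on leaves excludes a leaf. *)
Lemma ttn_mx_root t (j : 'I_(ttno_rank t)) : t = root -> (2 <= nleaves t)%N ->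
  ttn_mx hss_ttno t (tree_index t i) j =
  interaction_val beta (fun l => vec 1%:M (i l) 0)
    (fun l => vec (A l) (i l) 0) t.
Proof.
case: t j => [//|t1 t2] j def_root _.
have sub : subtree (Node t1 t2) root by rewrite def_root; apply: subtree_refl.
have gt1 := nleaves_gt0 t1; have gt2 := nleaves_gt0 t2.
rewrite ttn_mx_node //; first by rewrite /column_label -def_root eqxx.
- apply: subtree_coords_ok; first exact: subtree_childl sub.
  by rewrite -def_root /= -[X in X != _]addn0 eqn_add2l eq_sym -lt0n.
- apply: subtree_coords_ok; first exact: subtree_childr sub.
  by rewrite -def_root /= -[X in X != _]add0n eqn_add2r eq_sym -lt0n.
Qed.

End Construction.

Lemma hss_ttno_represents (F : fieldType) d (root : dtree d) (n : 'I_d -> nat)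
    (A : forall l : 'I_d, 'M[F]_(n l)) (beta : 'M[F]_d) (k : dtree d -> nat)
    (V : forall t, 'M[F]_(nleaves t, k t)) :
  (2 <= d)%N -> is_dimension_tree root -> leaves root = [set: 'I_d] ->
  (forall t1 t2, subtree (Node t1 t2) root ->
     leaf_block beta t1 t2 = V t1 *m hss_S beta V t1 t2 *m (V t2)^T) ->
  (forall t1 t2, subtree (Node t1 t2) root -> Node t1 t2 <> root ->
     V (Node t1 t2) = block_mx (V t1) 0 0 (V t2) *m hss_R V t1 t2) ->
  is_ttno root (interaction_op A beta) (hss_ttno A beta root V).
Proof.
move=> d_ge2 root_tree root_leaves hssS hssR.
have def_s := leaf_seq_root root_tree root_leaves.
exists (reshape (interaction_op A beta)).
  exists (@reshape F d n); split=> //; first exact: reshape_bij.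
  exact: reshape_kron.
have eq_size : tree_size (fun l => n l * n l)%N root =
    (\prod_(l < d) (n l * n l))%N.
  by rewrite tree_sizeE def_s big_enum.
have size_root : (2 <= nleaves root)%N.
  suff -> : nleaves root = size (leaf_seq root) by rewrite def_s size_enum_ord.
  by elim: (root) => //= t1 -> t2 ->; rewrite size_cat.
have rank_root : ttno_rank root k root = 1%N.
  by rewrite /ttno_rank; case: (root) size_root => // t1 t2; rewrite eqxx.
exists (eq_size, rank_root); apply/matrixP => p z.
rewrite castmxE mxE reshape_interaction.
(* The leaves of [root] are in increasing order, so tree positions agree with the vectorization in
   [tvec]. *)
have -> : cast_ord (esym eq_size) p = tree_index root (multi_index p).
  by apply: ord_inj; rewrite tree_index_multi_index.
rewrite ttn_mx_root // interaction_valE ?leaf_seq_pairwise // def_s big_enum.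
apply: eq_bigr => a _; rewrite big_enum_cond; apply: eq_bigr => b _.
by rewrite /mark big_enum.
Qed.

Theorem corollary4p2 (R : realType) (d : nat) (root : dtree d)
    (n : 'I_d -> nat) (A : forall l : 'I_d, 'M[R[i]]_(n l))
    (beta : 'M[R[i]]_d) (k : dtree d -> nat)
    (d_ge2 : (2 <= d)%N)
    (root_tree : is_dimension_tree root)
    (root_leaves : leaves root = [set: 'I_d])
    (beta_upper : strictly_upper_triangular beta)
    (beta_hss : has_hss root k beta) :
  exists (r : dtree d -> nat) (T : ttn R[i] (fun l => n l * n l)%N r),
    [/\ is_ttno root (interaction_op A beta) T,
        r root = 1%N,
        forall t1 t2 : dtree d, subtree (Node t1 t2) root ->
          Node t1 t2 <> root -> r (Node t1 t2) = (2 + k (Node t1 t2))%N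
      & forall l : 'I_d, r (Leaf l) = 2%N].
Proof.
have [V [hssS hssR]] := beta_hss.
exists (ttno_rank root k), (hss_ttno A beta root V).
have ttno : is_ttno root (interaction_op A beta) (hss_ttno A beta root V).
  apply: hss_ttno_represents => // t1 t2 sub.
    by have [S /hss_SP] := hssS t1 t2 sub.
  by move=> /(hssR t1 t2 sub)[Q /hss_RP].
(* The cast in the representation supplies the root rank. *)
have [H _ [[size1 rank1] _]] := ttno; split=> //.
(* A proper subtree has fewer leaves, so the test in [ttno_rank] selects [2 + k]. *)
move=> t1 t2 /subtree_nleaves[//|lt_t] _.
by rewrite /= (ltn_eqF lt_t).
Qed.
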